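(* Let $c(n)$ be a sequence of real numbers satisfying, as $n\to\infty$, $$c(n) \sim \frac{C}{n^\kappa} \exp\left(\sum_{\lambda\in\mathcal S} A_\lambda n^\lambda\right)$$ with $\kappa\in\mathbb R$, $\mathcal S\subset(0,1)$ a finite set of real numbers, and $C, A_\lambda\in\mathbb R$. Let $\lambda^* := \max\{\lambda\in\mathcal S: A_\lambda\neq 0\}$ and assume $A_{\lambda^*}>0$. Then, for $a,b\gg 1$, $$c(a)c(b) > c(a+b),$$ i.e. there exists $n_0$ such that this inequality holds for all integers $a,b\ge n_0$.
   Context: Here $f(n)\sim g(n)$ means that $f(n)/g(n)\to1$ as $n\to\infty$ (in particular the right-hand side is nonzero). *)

(* Defs.v *)
From HB Require Import structures.
From mathcomp Require Import all_boot all_order all_algebra finmap.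
From mathcomp Require Import all_classical all_reals all_analysis.

Set Implicit Arguments.
Unset Strict Implicit.
Unset Printing Implicit Defensive.

Import Order.TTheory GRing.Theory Num.Theory.
Import numFieldNormedType.Exports.

Local Open Scope classical_set_scope.
Local Open Scope ring_scope.

(* Since x / 0 = 0 here, the limit 1 forces g n != 0 for all large n.  The
   relation [f ~_F g] of landau.v is f = g + o(g), which also relates
   sequences that vanish eventually. *)
Definition asymp_equiv (R : realType) (f g : nat -> R) : Prop :=
  (fun n : nat => f n / g n) @ \oo --> (1 : R).

Definition is_max (R : realType) (E : set R) (m : R) : Prop :=
  E m /\ ubound E m.

(* Main.v *)
Require Import Defs.
From HB Require Import structures.
From mathcomp Require Import all_boot all_order all_algebra finmap.
From mathcomp Require Import all_classical all_reals all_analysis.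
From mathcomp Require Import ring lra.

Import Order.TTheory GRing.Theory Num.Theory.
Import numFieldNormedType.Exports.

Local Open Scope classical_set_scope.
Local Open Scope ring_scope.

(** Write g for the right-hand side of the asymptotics,
    with exponent P(x) = sum of the A_l x^l, and suppose C > 0. Then
    g(x) g(y) / g(x + y) is the exponential of
      ln C - kappa (ln x + ln y - ln (x + y))
        + sum of A_l (x^l + y^l - (x + y)^l),
    so everything depends on how far each power fails to be additive. By
    symmetry let x <= y. For 0 < l < 1 the defect x^l + y^l - (x + y)^l is
    comparable to x^l, uniformly in y: it lies between
    (1 - 2^(l - 1)) x^l ([powR_add_defect_ge]) and x^l. Similarly the
    logarithmic defect lies between 0 and ln x ([ln_add_defect_bounds]). Hence
    the exponent is at least a positive multiple of x^(lambda_star), minus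
    terms that involve only x and are of smaller order ([powR_dominates]). It
    therefore tends to infinity with the smaller argument, and
    g(x) g(y) > M g(x + y) for x, y large, whatever the factor M
    ([stretched_exp_supermul]).

    Such a factor absorbs the passage from g to c: once c(n) / g(n) lies
    between 1/2 and 2, the choice M = 8 gives
    c(a) c(b) > g(a) g(b) / 4 > 2 g(a + b) > c(a + b).
    If C < 0, then c is eventually negative and the claim is a comparison of
    signs; C = 0 contradicts the asymptotics. *)

(** * Defects of additivity of powers and of the logarithm *)

Lemma half_powR_lt1 (R : realType) (p : R) : 0 < p -> 2^-1 `^ p < 1 :> R.
Proof.
move=> p0; have := @gt0_ltr_powR R p p0 2^-1 1.
by rewrite powR1 !nnegrE; apply; lra.
Qed.

(** Put s = x / (x + y), so that s <= 1/2. Divided by (x + y)^l, the defect is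
    s^l + (1 - s)^l - 1. Since 1 - s <= 1, its power of exponent l < 1 is at
    least 1 - s, which leaves s^l - s = s^l (1 - s^(1 - l)), and
    s^(1 - l) <= 2^(l - 1). *)
Lemma powR_add_defect_ge (R : realType) (l x y : R) :
  0 < l < 1 -> 0 < x -> x <= y ->
  (1 - 2^-1 `^ (1 - l)) * x `^ l <= x `^ l + y `^ l - (x + y) `^ l.
Proof.
move=> /andP[l0 l1] x0 xy.
set s := x / (x + y).
have xy0 : 0 < x + y by lra.
have s0 : 0 < s by rewrite divr_gt0.
have s2 : s <= 2^-1 by rewrite /s ler_pdivrMr //; lra.
have Hx : x `^ l = (x + y) `^ l * s `^ l.
  rewrite -powRM ?(ltW xy0) ?(ltW s0) //; congr (_ `^ _).
  by rewrite /s mulrC divfK // gt_eqF.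
have Hy : (x + y) `^ l * (1 - s) <= y `^ l.
  have -> : y `^ l = (x + y) `^ l * (1 - s) `^ l.
    rewrite -powRM ?(ltW xy0) //; last by lra.
    by congr (_ `^ _); rewrite /s; field; rewrite gt_eqF.
  by rewrite ler_wpM2l ?powR_ge0 // ger1_powR ?(ltW l1) //; apply/andP; split; lra.
have Hs : s <= 2^-1 `^ (1 - l) * s `^ l.
  have {1}-> : s = s `^ (1 - l) * s `^ l.
    by rewrite -powRD ?subrK ?powRr1 ?(ltW s0) // gt_eqF // implybT.
  rewrite ler_wpM2r ?powR_ge0 //.
  by apply: ge0_ler_powR; rewrite ?nnegrE; lra.
move: (ler_wpM2l (powR_ge0 (x + y) l) Hs); rewrite [leRHS]mulrCA -Hx.
lra.
Qed.

Lemma powR_subadd (R : realType) (l x y : R) :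
  0 < l < 1 -> 0 < x -> x <= y -> (x + y) `^ l <= x `^ l + y `^ l.
Proof.
move=> l01 x0 xy; rewrite -subr_ge0.
apply: le_trans (powR_add_defect_ge R l x y l01 x0 xy).
case/andP: l01 => _ l1.
by rewrite mulr_ge0 ?powR_ge0 // subr_ge0 ltW // half_powR_lt1 // subr_gt0.
Qed.

(** The defect is the logarithm of x y / (x + y), which lies between x / 2 >= 1
    and x when 2 <= x <= y. *)
Lemma ln_add_defect_bounds (R : realType) (x y : R) : 2 <= x -> x <= y ->
  `|ln x + ln y - ln (x + y)| <= ln x.
Proof.
move=> x2 xy.
have [x0 y0 xy0] : [/\ 0 < x, 0 < y & 0 < x + y] by split; lra.
have h : 0 < x * y / (x + y) by rewrite divr_gt0 ?mulr_gt0.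
rewrite -lnM ?posrE // -ln_div ?posrE ?mulr_gt0 // ger0_norm.
  rewrite ler_ln ?posrE // ler_pdivrMr // ler_wpM2l //; lra.
by rewrite ln_ge0 // ler_pdivlMr // mul1r; nra.
Qed.

(** * Comparison of growth rates at infinity *)

Lemma powR_cvgy (R : realType) (s : R) : 0 < s -> x `^ s @[x --> +oo] --> +oo.
Proof.
move=> s0; apply/cvgryPge => M; near=> x.
apply: (@le_trans _ _ (Num.max 0 M)); first by rewrite le_max lexx orbT.
set m := Num.max 0 M.
have m0 : 0 <= m by rewrite le_max lexx.
have -> : m = (m `^ s^-1) `^ s by rewrite -powRrM mulVf ?gt_eqF // powRr1.
by apply: ge0_ler_powR; rewrite ?nnegrE ?powR_ge0 ?(ltW s0) //; near: x;
  apply: nbhs_pinfty_ge; rewrite num_real.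
Unshelve. all: by end_near. Qed.

Lemma powR_div_cvg0 (R : realType) (m l : R) : m < l ->
  x `^ m / x `^ l @[x --> +oo] --> 0.
Proof.
move=> ml; apply: (@cvg_trans _ ((x `^ (l - m))^-1 @[x --> +oo])).
  apply: near_eq_cvg; near=> x.
  have x0 : x != 0 by rewrite gt_eqF //; near: x; apply: nbhs_pinfty_gt; rewrite num_real.
  by rewrite -powRN opprB powRB // x0 implybT.
apply: (gtr0_cvgV0 (f := fun x : R => x `^ (l - m)) _).2.
  near=> x; apply: powR_gt0; near: x; apply: nbhs_pinfty_gt; rewrite num_real //.
by apply: powR_cvgy; rewrite subr_gt0.
Unshelve. all: by end_near. Qed.

(** From ln u <= u - 1 at u = x^(l / 2): the logarithm is bounded by a multiple
    of x^(l / 2), which is of smaller order than x^l. *)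
Lemma ln_div_powR_cvg0 (R : realType) (l : R) : 0 < l ->
  ln x / x `^ l @[x --> +oo] --> 0.
Proof.
move=> l0.
have l20 : 0 < l / 2 by rewrite divr_gt0.
apply: (@squeeze_cvgr _ _ _ _ (fun=> 0) (fun x => (l / 2)^-1 * (x `^ (l / 2) / x `^ l))).
- near=> x.
  have x1 : 1 <= x by near: x; apply: nbhs_pinfty_ge; rewrite num_real.
  rewrite divr_ge0 ?ln_ge0 ?powR_ge0 //= mulrA ler_wpM2r ?invr_ge0 ?powR_ge0 //.
  rewrite mulrC ler_pdivlMr // mulrC -ln_powR.
  have := @le_ln1Dx R (x `^ (l / 2) - 1); rewrite addrCA subrr addr0.
  have : 0 < x `^ (l / 2) by apply: powR_gt0; lra.
  by move=> h /(_ ltac:(lra)); lra.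
- exact: cvg_cst.
- rewrite -[X in _ --> X](mulr0 (l / 2)^-1); apply: cvgM; first exact: cvg_cst.
  by apply: powR_div_cvg0; rewrite ltr_pdivrMr //; lra.
Unshelve. all: by end_near. Qed.

(** Divided by x^l, each term on the left tends to 0; the constant K is treated
    as K x^0. Exponents with zero coefficient are exempt from m < l because
    lambda_star is maximal only among those with nonzero coefficient. *)
Lemma powR_dominates (R : realType) (S : {fset R}) (B : R -> R) (l k K d : R) :
  0 < l -> (forall m, m \in S -> B m != 0 -> m < l) -> 0 < d ->
  \forall x \near +oo, K + k * ln x + \sum_(m <- S) B m * x `^ m < d * x `^ l.
Proof.
move=> l0 BS d0.
have h : (K * (x `^ 0 / x `^ l) + k * (ln x / x `^ l) +
    \sum_(m <- S | m \in S) B m * (x `^ m / x `^ l)) @[x --> +oo] --> 0.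
  rewrite [X in _ --> X](_ : 0 = K * 0 + k * 0 + \sum_(m <- S | m \in S) 0); last first.
    by rewrite big1 // !mulr0 !addr0.
  apply: cvgD; [apply: cvgD|].
  - by apply: cvgM; [exact: cvg_cst|exact: powR_div_cvg0].
  - by apply: cvgM; [exact: cvg_cst|exact: ln_div_powR_cvg0].
  - apply: cvg_big => [|m mS]; first exact: add_continuous.
    have [-> |Bm] := eqVneq (B m) 0.
      by under eq_fun do rewrite mul0r; exact: cvg_cst.
    rewrite -[X in _ --> X](mulr0 (B m)); apply: cvgM; first exact: cvg_cst.
    exact: powR_div_cvg0 (BS _ _ _).
near=> x.
have x0 : 0 < x by near: x; apply: nbhs_pinfty_gt; rewrite num_real.
rewrite -ltr_pdivrMr ?powR_gt0 // !mulrDl mulr_suml.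
rewrite (_ : \sum_(m <- S) _ = \sum_(m <- S | m \in S) B m * (x `^ m / x `^ l)).
  rewrite -[K in K / _]mulr1 -(powRr0 x) -!mulrA.
  by near: x; exact: (cvgr_lt _ h).
by rewrite [LHS]big_seq; apply: eq_bigr => m _; rewrite mulrA.
Unshelve. all: by end_near. Qed.

(** * Supermultiplicativity of stretched exponentials *)

(** The lower bound involves only the smaller argument x, so growth in one
    variable suffices afterwards. Only the leading power needs its defect
    bounded below; for the others, where A m may have either sign, the defect
    lies between 0 and x^m. *)
Lemma exponent_add_defect_ge (R : realType) (S : {fset R}) (A : R -> R)
    (l k x y : R) : (forall m, m \in S -> 0 < m < 1) -> l \in S -> 0 <= A l ->
  2 <= x -> x <= y ->
  A l * (1 - 2^-1 `^ (1 - l)) * x `^ l - `|k| * ln x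
    - \sum_(m <- (S `\ l)%fset) `|A m| * x `^ m <=
  \sum_(m <- S) A m * (x `^ m + y `^ m - (x + y) `^ m)
    - k * (ln x + ln y - ln (x + y)).
Proof.
move=> S01 lS Al x2 xy.
have x0 : 0 < x by lra.
rewrite (big_fsetD1 _ lS) /= [leRHS]addrAC; apply: lerD; first apply: lerD.
- by rewrite -mulrA ler_wpM2l // powR_add_defect_ge // S01.
- rewrite lerN2 (le_trans (ler_norm _)) // normrM ler_wpM2l //.
  exact: ln_add_defect_bounds.
- rewrite -sumrN big_seq [leRHS]big_seq; apply: ler_sum => m.
  rewrite in_fsetD1 => /andP[_ /S01 m01].
  rewrite lerNl (le_trans (ler_norm _)) // normrN normrM ler_wpM2l //.
  have h1 := powR_subadd R m x y m01 x0 xy.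
  have h2 : y `^ m <= (x + y) `^ m.
    case/andP: m01 => m0 _.
    by apply: ge0_ler_powR; rewrite ?nnegrE; lra.
  rewrite ger0_norm; lra.
Qed.

Definition stretched_exp (R : realType) (C k : R) (S : {fset R}) (A : R -> R)
  (x : R) : R := C / x `^ k * expR (\sum_(m <- S) A m * x `^ m).

Lemma stretched_expE (R : realType) (C k : R) (S : {fset R}) (A : R -> R)
  (x : R) : 0 < C -> 0 < x -> stretched_exp R C k S A x =
  expR (ln C - k * ln x + \sum_(m <- S) A m * x `^ m).
Proof.
move=> C0 x0.
by rewrite /stretched_exp 2!expRD expRN lnK ?posrE // /powR gt_eqF.
Qed.

(** The factor M costs only the constant ln M in the exponent, which
    [powR_dominates] absorbs along with ln C and the logarithmic term. *)
Lemma stretched_exp_supermul (R : realType) (C k : R) (S : {fset R})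
    (A : R -> R) (l M : R) :
  (forall m, m \in S -> 0 < m < 1) -> is_max [set m | m \in S /\ A m != 0] l ->
  0 < A l -> 0 < C -> 0 < M ->
  \forall X \near +oo, forall x y : R, X <= x -> X <= y ->
    M * stretched_exp R C k S A (x + y) <
    stretched_exp R C k S A x * stretched_exp R C k S A y.
Proof.
move=> S01 [[lS _] lmax] Al C0 M0.
have /andP[l0 l1] := S01 _ lS.
set d := A l * (1 - 2^-1 `^ (1 - l)).
have d0 : 0 < d.
  by rewrite /d mulr_gt0 // subr_gt0 half_powR_lt1 // subr_gt0.
have dom : \forall x \near +oo,
    ln M - ln C + `|k| * ln x + \sum_(m <- (S `\ l)%fset) `|A m| * x `^ m < d * x `^ l.
  apply: powR_dominates => // m; rewrite in_fsetD1 normr_eq0 => /andP[ml mS] Am.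
  by rewrite lt_neqAle ml lmax.
have [X0 [_ HX]] := dom.
exists (Num.max 2 X0); split; first by rewrite num_real.
move=> X; rewrite gt_max => /andP[X2 X0X] x y.
wlog xy : x y / x <= y => [H Xx Xy|].
  have [/H->//|/ltW /H] := leP x y.
  by rewrite (addrC x) (mulrC (stretched_exp _ _ _ _ _ x)); apply.
move=> Xx _.
have x2 : 2 <= x by lra.
have := exponent_add_defect_ge R S A l k x y S01 lS (ltW Al) x2 xy.
have := HX x (lt_le_trans X0X Xx).
have [x0 y0 xy0] : [/\ 0 < x, 0 < y & 0 < x + y] by split; lra.
rewrite !stretched_expE //.
have EM : M = expR (ln M) by rewrite lnK ?posrE.
rewrite -/d -expRD [X in X * expR _ < _]EM -expRD ltr_expR.
rewrite (_ : \sum_(m <- S) A m * (x `^ m + y `^ m - (x + y) `^ m) =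
  \sum_(m <- S) A m * x `^ m + \sum_(m <- S) A m * y `^ m
  - \sum_(m <- S) A m * (x + y) `^ m); first by lra.
by rewrite -sumrN -!big_split /=; apply: eq_bigr => m _; ring.
Qed.

(** * From the asymptotic model to the sequence *)

Lemma ltr_mul_of_half_double (R : realFieldType) (u v w u' v' w' : R) :
  2^-1 * u < u' < 2 * u -> 2^-1 * v < v' < 2 * v -> 2^-1 * w < w' < 2 * w ->
  8 * w < u * v -> w' < u' * v'.
Proof.
move=> /andP[hu hu'] /andP[hv hv'] /andP[_ hw] huvw.
have : 2^-1 * u * (2^-1 * v) < u' * v' by rewrite ltr_pM //; lra.
have -> : 2^-1 * u * (2^-1 * v) = u * v / 4 by field.
by lra.
Qed.

Theorem theorem1p5 (R : realType) (c : nat -> R) (C kappa : R)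
    (S : {fset R}) (A : R -> R) (lambda_star : R)
    (S01 : forall l : R, l \in S -> 0 < l < 1)
    (c_asymp : asymp_equiv c (fun n : nat =>
       C / (n%:R `^ kappa) * expR (\sum_(l <- S) A l * n%:R `^ l)))
    (lambda_star_max :
       is_max [set l : R | l \in S /\ A l != 0] lambda_star)
    (A_lambda_star_gt0 : 0 < A lambda_star) :
  exists n0 : nat, forall a b : nat,
    (n0 <= a)%N -> (n0 <= b)%N -> c a * c b > c (a + b)%N.
Proof.
pose g (x : R) := stretched_exp R C kappa S A x.
have lo := cvgr_gt _ c_asymp (2^-1) ltac:(lra).
have hi := cvgr_lt _ c_asymp 2 ltac:(lra).
have pos : \forall n \near \oo, (0 < n)%N by exact: nbhs_infty_gt.
have [C0|C0|C0] := ltrgtP C 0.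
- have neg : \forall n \near \oo, c n < 0.
    near=> n.
    have n0 : (0 < n)%N by near: n.
    have : 2^-1 < c n / g n%:R by near: n.
    rewrite /g.
    have gn : stretched_exp R C kappa S A n%:R < 0.
      by rewrite pmulr_llt0 ?expR_gt0 // nmulr_rlt0 // invr_gt0 powR_gt0 // ltr0n.
    by rewrite ltr_ndivlMr //; lra.
  have [n0 _ H] := neg; exists n0 => a b na nb.
  apply: (@lt_trans _ _ 0); first by apply: H; rewrite /= (leq_trans na) // leq_addr.
  by rewrite nmulr_rgt0; apply: H.
- have super : \forall n \near \oo, forall x y : R, n%:R <= x -> n%:R <= y ->
      8 * g (x + y) < g x * g y.
    apply: (@cvgr_idn R _ (@stretched_exp_supermul R C kappa S A lambda_star 8 _ _ _ _ _)) => //.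
  have bnd : \forall n \near \oo, 2^-1 * g n%:R < c n < 2 * g n%:R.
    near=> n.
    have n0 : (0 < n)%N by near: n.
    have gn : 0 < g n%:R.
      by rewrite mulr_gt0 ?expR_gt0 // divr_gt0 // powR_gt0 // ltr0n.
    apply/andP; split; first by rewrite -ltr_pdivlMr //; near: n.
    by rewrite -ltr_pdivrMr //; near: n.
  have [n1 _ H1] := super; have [n2 _ H2] := bnd.
  exists (maxn n1 n2) => a b; rewrite !geq_max => /andP[a1 a2] /andP[b1 b2].
  have cab := H2 (a + b)%N (leq_trans a2 (leq_addr _ _)).
  apply: (ltr_mul_of_half_double _ _ _ _ _ _ _ (H2 a a2) (H2 b b2) cab).
  by rewrite natrD; apply: (H1 n1 (leqnn _)); rewrite ler_nat.
- (* Division by zero yields zero here, so for C = 0 the ratio vanishes. *)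
  have [n _ /(_ n (leqnn n))] := lo.
  by rewrite /= C0 !mul0r invr0 mulr0 => h; lra.
Unshelve. all: by end_near. Qed.
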